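(* For any $c\ge -\dfrac{169k_2^2}{1200k_1}$, the equation $$m_t+k_1\big((2\mu(u)u-u_x^2)m\big)_x+k_2(2mu_x+um_x)=0,\qquad m=\mu(u)-u_{xx},$$ admits the peaked period-one traveling wave solution $u_c=\phi_c(\xi)$, $\xi=x-ct$, where $\phi_c(\xi)$ is given by $$\phi_c(\xi)=a\Big[\tfrac12\big(\xi-\tfrac12\big)^2+\tfrac{23}{24}\Big]$$ with $$a=\begin{cases}\dfrac{-13k_2\pm\sqrt{169k_2^2+1200\,c\,k_1}}{50k_1}, & k_1\neq 0,\\[3mm] \dfrac{12c}{13k_2}, & k_1=0,\ k_2\neq 0,\end{cases}$$ for $\xi\in[-1/2,1/2]$, and $\phi_c(\xi)$ is extended periodically to the real line.
   Context: $k_1,k_2$ are real parameters of the equation, $\mathbb{S}=\mathbb{R}/\mathbb{Z}$, functions of $x$ are $1$-periodic, and $\mu(u)=\int_{\mathbb{S}}u(t,x)\,dx$. Solutions are understood in the following weak sense. Let $g(x)=\frac12(x-\frac12)^2+\frac{23}{24}$ for $0\le x<1$, extended $1$-periodically (the Green function of $A=\mu-\partial_x^2$, i.e. $A^{-1}f=g*f$ with convolution on $\mathbb{S}$), and let $g_x$ be its derivative, with $g_x(0)=0$ and $g_x(x)=x-\frac12$ for $0<x<1$. Given $u_0\in W^{1,3}(\mathbb{S})$, a function $u\in L^\infty([0,T),W^{1,3}(\mathbb{S}))$ is a weak solution with initial data $u_0$ if for every $\varphi\in C_c^\infty([0,T)\times\mathbb{S})$ $$\int_0^T\!\!\int_{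\mathbb{S}}\Big[u\varphi_t+k_1\Big(\mu(u)u^2\varphi_x+\tfrac13u_x^3\varphi-\big(g_x*(2\mu^2(u)u+\mu(u)u_x^2)\big)\varphi-\tfrac13\mu(u_x^3)\varphi\Big)+k_2\Big(\tfrac12u^2\varphi_x-\big(g_x*(2u\mu(u)+\tfrac12u_x^2)\big)\varphi\Big)\Big]dx\,dt+\int_{\mathbb{S}}u_0(x)\varphi(0,x)\,dx=0.$$
   Formalization: The quadratic is the profile for ξ∈[0,1), with |ξ| replacing ξ on [-1/2,1/2] (as printed it would jump); for k1<0 the bound on c is reversed so that a is real; for k1=0 no bound on c is imposed; the peak is asserted only for a≠0. *)

(* Defs.v *)
From HB Require Import structures.
From mathcomp Require Import all_boot all_order all_algebra.
From mathcomp Require Import all_classical all_reals all_analysis.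
From mathcomp Require Import ring lra.
Set Implicit Arguments.
Unset Strict Implicit.
Unset Printing Implicit Defensive.
Import Order.TTheory GRing.Theory Num.Theory.
Import numFieldNormedType.Exports.
Local Open Scope ring_scope.
Local Open Scope classical_set_scope.

(* Functions on the circle S = R/Z are functions on R of period 1, and
   integrals over S are integrals over [0, 1]. *)

Section circle.
Context {R : realType}.
Notation mu := (@lebesgue_measure R).
Implicit Types (f fx h : R -> R).

Definition periodize f (x : R) : R := f (x - (Num.floor x)%:~R).

Definition integralS f : R := \int[mu]_(x in `[0, 1]) f x.

Definition convS f h (x : R) : R := integralS (fun y => f (x - y) * h y).

(* The Green function g of A = mu - (d/dx)^2, and its derivative g_x, with the
   convention g_x(0) = 0 at the corner. *)
Definition green : R -> R :=
  periodize (fun x => 2^-1 * (x - 2^-1) ^+ 2 + 23 / 24).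

Definition green_x : R -> R :=
  periodize (fun x => if x == 0 then 0 else x - 2^-1).

Definition smoothS (psi : R -> R) : Prop :=
  periodic psi 1 /\ forall n x, derivable (derive1n n psi) x 1.

Definition weak_derivS f fx : Prop := forall psi : R -> R, smoothS psi ->
  integralS (fun x => f x * derive1 psi x) = - integralS (fun x => fx x * psi x).

Definition W13_norm f fx : \bar R :=
  ((\int[mu]_(x in `[0%R, 1%R]) (`|f x| ^+ 3)%:E +
    \int[mu]_(x in `[0%R, 1%R]) (`|fx x| ^+ 3)%:E) `^ (3^-1)%R)%E.

(* f is in W^{1,3}(S), with weak derivative (represented by) fx. *)
Definition in_W13 f fx : Prop :=
  [/\ periodic f 1 /\ periodic fx 1,
      measurable_fun setT f /\ measurable_fun setT fx,
      weak_derivS f fx & (W13_norm f fx < +oo)%E].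

End circle.

Section space_time.
Context {R : realType}.
Notation mu := (@lebesgue_measure R).
Implicit Types (T : R) (u ux phi : R -> R -> R).

Definition deriv_t phi (t x : R) : R := derive1 (fun s => phi s x) t.
Definition deriv_x phi (t x : R) : R := derive1 (phi t) x.

Fixpoint Ck (n : nat) phi : Prop :=
  continuous (fun p : R * R => phi p.1 p.2) /\
  if n is m.+1 then
    [/\ forall t x, derivable (fun s => phi s x) t 1,
        forall t x, derivable (phi t) x 1,
        Ck m (deriv_t phi) & Ck m (deriv_x phi)]
  else True.

(* C_c^oo([0, T) x S).  Such functions are the restrictions to t >= 0 of
   functions that are smooth for all real t; the support stays away from
   t = T but may contain t = 0. *)
Definition test_function T phi : Prop :=
  [/\ forall n, Ck n phi,
      forall t, periodic (phi t) 1 &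
      exists2 T', T' < T & forall t x, T' <= t -> phi t x = 0].

(* u is in L^oo([0, T), W^{1,3}(S)), with spatial weak derivative ux.  As
   W^{1,3}(S) is separable, strong measurability of t |-> u(t, .) amounts to
   joint measurability of (representatives of) u and u_x. *)
Definition in_Linfty_W13 T u ux : Prop :=
  [/\ measurable_fun [set p : R * R | 0 <= p.1 < T] (fun p => u p.1 p.2),
      measurable_fun [set p : R * R | 0 <= p.1 < T] (fun p => ux p.1 p.2),
      {ae mu, forall t, 0 <= t < T -> in_W13 (u t) (ux t)} &
      exists M : R,
        {ae mu, forall t, 0 <= t < T -> (W13_norm (u t) (ux t) <= M%:E)%E}].

Definition weak_integrand (k1 k2 : R) u ux phi (t x : R) : R :=
  let mean := integralS (u t) in
  u t x * deriv_t phi t x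
  + k1 * (mean * u t x ^+ 2 * deriv_x phi t x
          + 3^-1 * ux t x ^+ 3 * phi t x
          - convS green_x (fun y => 2 * mean ^+ 2 * u t y + mean * ux t y ^+ 2) x
            * phi t x
          - 3^-1 * integralS (fun y => ux t y ^+ 3) * phi t x)
  + k2 * (2^-1 * u t x ^+ 2 * deriv_x phi t x
          - convS green_x (fun y => 2 * u t y * mean + 2^-1 * ux t y ^+ 2) x
            * phi t x).

Definition weak_solution (k1 k2 T : R) (u0 : R -> R) u : Prop :=
  (exists u0x, in_W13 u0 u0x) /\
  exists2 ux, in_Linfty_W13 T u ux &
  forall phi, test_function T phi ->
    \int[mu]_(t in `[0, T[) integralS (weak_integrand k1 k2 u ux phi t)
    + integralS (fun x => u0 x * phi 0 x) = 0.

End space_time.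

Section peakon.
Context {R : realType}.

(* The quadratic is the profile on the period [0, 1]; see [peakon_centered] for
   its form on the period [-1/2, 1/2], which has the crest in its middle. *)
Definition peakon (a : R) : R -> R :=
  periodize (fun xi => a * (2^-1 * (xi - 2^-1) ^+ 2 + 23 / 24)).

Lemma peakon_centered (a xi : R) : `|xi| <= 2^-1 ->
  peakon a xi = a * (2^-1 * (`|xi| - 2^-1) ^+ 2 + 23 / 24).
Proof.
rewrite ler_norml /peakon /periodize => /andP[xil xiu].
have [xi0|xi0] := leP 0 xi.
  suff -> : Num.floor xi = 0 by rewrite mulr0z subr0 ger0_norm.
  by apply: floor_def; rewrite add0r mulr0z mulr1z; apply/andP; split; lra.
suff -> : Num.floor xi = -1 by rewrite ltr0_norm// rmorphN1; field.
by apply: floor_def; rewrite addNr mulr0z rmorphN1; apply/andP; split; lra.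
Qed.

Lemma peakon_green (a xi : R) : peakon a xi = a * green xi.
Proof. by []. Qed.

(* A peak: the one-sided derivatives at x are finite, nonzero and opposite. *)
Definition has_peak (phi : R -> R) (x : R) : Prop :=
  exists2 l : R, l != 0 &
    (h^-1 * (phi (x + h) - phi x) @[h --> 0^'-] --> l) /\
    (h^-1 * (phi (x + h) - phi x) @[h --> 0^'+] --> - l).

End peakon.

(* Main.v *)
Require Import Defs.
From HB Require Import structures.
From mathcomp Require Import all_boot all_order all_algebra.
From mathcomp Require Import all_classical all_reals all_analysis.
From mathcomp Require Import measurable_realfun ring lra.
Import Order.TTheory GRing.Theory Num.Theory.
Import numFieldNormedType.Exports.
Local Open Scope classical_set_scope.
Local Open Scope ring_scope.

(* The peakon is a g(x - c t), with g the Green function of mu - (d/dx)^2, and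
   12 c = 25 k1 a^2 + 13 k2 a.  Write G = g(x - c t) and G_x = g_x(x - c t);
   then G G_x = G_x^3 / 2 + 23 G_x / 24, the convolutions in the weak form are
   multiples of G_x^3 / 3 - G_x / 12, and the integrand collapses pointwise to
     a G phi_t + (k1 a^3 + k2 a^2 / 2) (G^2 phi)_x - a c G_x phi
   (all of this also at the crest, by the convention g_x(0) = 0).
   Integrating by parts over the circle leaves the integral of
   a G (phi_t + c phi_x), the time derivative of the integral of a G phi, whose
   value is 0 at t = T and cancels the initial term at t = 0. *)

(** * Functions on the circle *)

Section circle_functions.
Set Implicit Arguments.
Unset Strict Implicit.
Context {R : realType}.
Notation mu := (@lebesgue_measure R).
Implicit Types (f h : R -> R) (x y s : R).

Lemma periodic_int f (n : int) x : periodic f 1 -> f (x - n%:~R) = f x.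
Proof.
move=> pf; have pfn (k : nat) y : f (y + k%:R) = f y by rewrite periodicn.
case: n => n; first by rewrite -[x in RHS](subrK n%:R) pfn.
by rewrite NegzE mulrNz opprK pfn.
Qed.

Lemma frac_itv x : 0 <= x - (Num.floor x)%:~R < 1.
Proof.
by have := floor_itv x; rewrite intrD => /andP[? ?]; apply/andP; split; lra.
Qed.

Lemma periodize_periodic f : periodic (periodize f) 1.
Proof.
move=> x; rewrite /periodize floorDrz ?intr_int// floor1 intrD opprD.
by congr f; ring.
Qed.

Lemma periodize_id f x : 0 <= x < 1 -> periodize f x = f x.
Proof.
by move=> x01; rewrite /periodize (@floor_def _ x 0) ?subr0.
Qed.

Lemma measurable_periodize f :
  measurable_fun setT f -> measurable_fun setT (periodize f).
Proof.
move=> mf; apply: (measurableT_comp mf); apply: measurable_funB => //.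
apply: nondecreasing_measurable => // x y xy.
by rewrite ler_int; exact: le_floor.
Qed.

(** This class is closed under sums, products, powers, translation and reflection, and its members
    are integrable on bounded intervals. It discharges the integrability side conditions on the
    circle. *)
Definition circular f :=
  [/\ periodic f 1, measurable_fun setT f & exists M, forall x, `|f x| <= M].

Lemma circular_periodize f : measurable_fun setT f ->
  (exists M, forall x, 0 <= x < 1 -> `|f x| <= M) -> circular (periodize f).
Proof.
move=> mf [M fM]; split; [exact: periodize_periodic|exact: measurable_periodize|].
by exists M => x; apply: fM; exact: frac_itv.
Qed.

Lemma circular_cst (k : R) : circular (fun=> k).
Proof. by split=> //; exists `|k|. Qed.

Lemma circularD f h : circular f -> circular h -> circular (fun x => f x + h x).
Proof.
move=> [pf mf [M fM]] [ph mh [N hN]]; split.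
- by move=> x; rewrite pf ph.
- exact: measurable_funD.
- exists (M + N) => x; apply: (le_trans (ler_normD _ _)); exact: lerD.
Qed.

Lemma circularM f h : circular f -> circular h -> circular (fun x => f x * h x).
Proof.
move=> [pf mf [M fM]] [ph mh [N hN]]; split.
- by move=> x; rewrite pf ph.
- exact: measurable_funM.
- by exists (M * N) => x; rewrite normrM ler_pM.
Qed.

Lemma circularZ (k : R) f : circular f -> circular (fun x => k * f x).
Proof. by apply: circularM; exact: circular_cst. Qed.

Lemma circularX f n : circular f -> circular (fun x => f x ^+ n).
Proof.
move=> cf; elim: n => [|n ih]; first exact: circular_cst.
by under eq_fun do rewrite exprS; exact: circularM.
Qed.

Lemma circular_shift f s : circular f -> circular (fun x => f (x + s)).
Proof.
move=> [pf mf [M fM]]; split.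
- by move=> x; rewrite addrAC pf.
- by apply: (measurableT_comp mf); exact: measurable_funD.
- by exists M.
Qed.

Lemma circular_reflect f s : circular f -> circular (fun x => f (s - x)).
Proof.
move=> [pf mf [M fM]]; split.
- by move=> x; rewrite -[LHS]pf opprD addrA subrK.
- by apply: (measurableT_comp mf); exact: measurable_funB.
- by exists M.
Qed.

Lemma circular_continuous f : periodic f 1 -> continuous f -> circular f.
Proof.
move=> pf cf; split => //; first exact: continuous_measurable_fun.
have : compact (f @` `[0, 1]).
  apply: continuous_compact (@segment_compact R 0 1).
  exact: continuous_subspaceT.
(* [compact_bounded] gives a bound for each number strictly above [M], hence [M + 1]; periodicity
   carries it from the unit interval to the line. *)
move=> /compact_bounded[M [_ Mf]]; exists (M + 1) => x.
rewrite -(periodic_int (Num.floor x) x pf); apply: (Mf (M + 1)); first by rewrite ltrDl.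
exists (x - (Num.floor x)%:~R) => //=; rewrite in_itv/=.
by have /andP[-> /ltW ->] := frac_itv x.
Qed.

Lemma circular_integrable f (a b : R) (l r : bool) : circular f ->
  mu.-integrable [set` Interval (BSide l a) (BSide r b)] (EFin \o f).
Proof.
move=> [_ mf [M fM]]; apply: measurable_bounded_integrable => //.
- rewrite /= lebesgue_measure_itv/=; case: ifP => _ //.
  by rewrite -EFinB ltry.
- exact: measurable_funTS.
- exists M; split; first exact: num_real.
  by move=> N MN x _ /=; exact/ltW/(le_lt_trans (fM x)).
Qed.

(** Lebesgue measure is characterised by its values on the intervals []a, b]], whose lengths a
    translation preserves. *)
Lemma pushforward_shift s (X : set R) : measurable X ->
  pushforward mu (fun x : measurableTypeR R => x + s : measurableTypeR R) X = mu X.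
Proof.
have mshift : measurable_fun [set: measurableTypeR R]
    (fun x : measurableTypeR R => x + s : measurableTypeR R).
  exact: measurable_funD.
(* The map is packed as a measurable function so that its pushforward is recognised as a measure. *)
move=> mX; pose phi : {mfun measurableTypeR R >-> measurableTypeR R} :=
  HB.pack (fun x : measurableTypeR R => x + s : measurableTypeR R)
    (isMeasurableFun.Build _ _ _ _ _ mshift).
apply/esym/(@lebesgue_measure_unique _ (pushforward mu phi)) => //= _ [[a b]] _ <-.
have E : (fun x => x + s) @^-1` `]a, b] = `]a - s, b - s]%classic.
  by apply/seteqP; split=> x /=; rewrite !in_itv/= ltrBlDr lerBrDr.
rewrite /pushforward/= [X in _ = lebesgue_measure X]E.
rewrite !lebesgue_measure_itv/= !lte_fin ltrD2r.
by case: ifP => // _; rewrite -!EFinB opprB addrA subrK.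
Qed.

Lemma Rintegral_shift f s (a b : R) (l r : bool) : circular f ->
  \int[mu]_(x in [set` Interval (BSide l a) (BSide r b)]) f (x + s) =
  \int[mu]_(x in [set` Interval (BSide l (a + s)) (BSide r (b + s))]) f x.
Proof.
move=> cf; set I := Interval (BSide l a) _; set J := Interval _ _.
have IJ : [set` I] = (+%R^~ s) @^-1` [set` J].
  by apply/seteqP; split=> x /=; rewrite !in_itv/=; case: l {I J} r => -[] /=;
    rewrite ?lerD2r ?ltrD2r.
have mshift : measurable_fun [set: measurableTypeR R]
    (fun x : measurableTypeR R => x + s : measurableTypeR R).
  exact: measurable_funD.
have [_ mf _] := cf.
rewrite /Rintegral IJ -(@integral_pushforward _ _ _ _ _ _ mshift mu _ (EFin \o f))//.
- congr fine; apply: eq_measure_integral => X mX _ /=.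
  exact: pushforward_shift.
- exact/measurable_EFinP.
- by rewrite -IJ; exact: (circular_integrable _ _ _ _ (circular_shift s cf)).
Qed.

Lemma Rintegral_chasles f (a b c : R) : circular f -> a <= b -> b <= c ->
  \int[mu]_(x in `[a, c]) f x =
  \int[mu]_(x in `[a, b]) f x + \int[mu]_(x in `[b, c]) f x.
Proof.
move=> cf ab bc; rewrite -[X in _ = _ + X]Rintegral_itv_obnd_cbnd; last first.
  exact: circular_integrable.
rewrite -(@Rintegral_itvB _ f (BLeft a) (BRight c) b) ?bnd_simp//.
  by rewrite addrC subrK.
exact: circular_integrable.
Qed.

(** An interval of length one covers the circle once: cut [[s, 1 + s]] at 1 and move the second
    piece back by one period. *)
Lemma integralS_shift f s : circular f ->
  integralS (fun x => f (x + s)) = integralS f.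
Proof.
move=> cf; have [pf _ _] := cf.
wlog s01 : s / 0 <= s < 1.
  move=> /(_ _ (frac_itv s)) <-; apply: eq_Rintegral => x _.
  by rewrite addrA periodic_int.
have /andP[s0 s1] := s01.
rewrite /integralS Rintegral_shift// add0r.
rewrite (@Rintegral_chasles _ s 1)//; [|exact: ltW|by rewrite lerDl].
rewrite -{2}[1]add0r [1 + s]addrC -Rintegral_shift//.
under [X in _ + X]eq_Rintegral do rewrite pf.
by rewrite addrC -Rintegral_chasles// ltW.
Qed.

(** Endpoints are null. This allows replacing [green_x], whose value at the corner is a convention,
    by x - 1/2 over a whole period. *)
Lemma eq_Rintegral_oo f h (a b : R) :
  mu.-integrable `[a, b] (EFin \o f) -> mu.-integrable `[a, b] (EFin \o h) ->
  {in `]a, b[, f =1 h} ->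
  \int[mu]_(x in `[a, b]) f x = \int[mu]_(x in `[a, b]) h x.
Proof.
move=> intf inth fh.
have itv_oo k : mu.-integrable `[a, b] (EFin \o k) ->
    \int[mu]_(x in `[a, b]) k x = \int[mu]_(x in `]a, b[) k x.
  move=> intk; rewrite -Rintegral_itv_obnd_cbnd; last first.
    by apply: integrableS intk => //; apply: subset_itvr; rewrite bnd_simp.
  rewrite -Rintegral_itv_bndo_bndc//.
  by apply: integrableS intk => //; exact: subset_itv_oo_cc.
by rewrite !itv_oo//; apply: eq_Rintegral => x; rewrite inE => /fh.
Qed.

Lemma continuous_integrable f (a b : R) : continuous f ->
  mu.-integrable `[a, b] (EFin \o f).
Proof.
move=> cf; apply: continuous_compact_integrable; first exact: segment_compact.
exact: continuous_subspaceT.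
Qed.

Lemma is_derive_continuous (F f : R -> R) :
  (forall x, is_derive x 1 F (f x)) -> continuous F.
Proof. by move=> dF x; apply/differentiable_continuous/derivable1_diffP. Qed.

Lemma is_derive_LRcontinuous (F f : R -> R) (a b : R) :
  (forall x, is_derive x 1 F (f x)) -> derivable_oo_LRcontinuous F a b.
Proof.
move=> dF; have cF := is_derive_continuous dF; split=> //.
- exact/cvg_at_right_filter/cF.
- exact/cvg_at_left_filter/cF.
Qed.

(** Agreement of [h] with [f] is asked on the open interval only, so that the polynomial pieces of a
    function with a jump can be integrated one by one. *)
Lemma Rintegral_primitive (F f h : R -> R) (a b : R) : a <= b ->
  (forall x, is_derive x 1 F (f x)) -> continuous f ->
  mu.-integrable `[a, b] (EFin \o h) -> {in `]a, b[, h =1 f} ->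
  \int[mu]_(x in `[a, b]) h x = F b - F a.
Proof.
(* The degenerate interval does occur, in the convolution at [x = 0]; the fundamental theorem wants
   [a < b]. *)
rewrite le_eqVlt => /predU1P[<-|ab] dF cf inth hf.
  by rewrite set_itv1 Rintegral_set1 subrr.
rewrite (eq_Rintegral_oo inth (@continuous_integrable _ a b cf) hf).
rewrite /Rintegral (continuous_FTC2 ab (continuous_subspaceT cf)
  (@is_derive_LRcontinuous _ _ a b dF))//.
by move=> x _; rewrite derive1E derive_val.
Qed.

Lemma continuous_translate f s : continuous f -> continuous (fun x => f (x + s)).
Proof.
move=> cf x; apply: (@continuous_comp _ _ _ (fun y => y + s) f); last exact: cf.
by apply: cvgD; [exact: cvg_id|exact: cvg_cst].
Qed.

Lemma periodic_derive1 f : periodic f 1 -> periodic (derive1 f) 1.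
Proof.
by move=> pf x; rewrite /derive1; under eq_fun do rewrite addrA !pf.
Qed.

(** Here [F] is a C^1 model of [g] on one period. Translating by [s] puts the corner of [g] at the
    ends of [[0, 1]], where the boundary terms cancel by periodicity, so a jump of [gx] contributes
    nothing. *)
Lemma integralS_by_parts (F f : R -> R) (g gx : R -> R) (psi : R -> R) s :
  (forall x, is_derive x 1 F (f x)) -> continuous f ->
  circular g -> circular gx -> {in `[0, 1], g =1 F} -> {in `]0, 1[, gx =1 f} ->
  periodic psi 1 -> (forall x, derivable psi x 1) -> continuous (derive1 psi) ->
  integralS (fun x => g (x - s) * derive1 psi x) =
  - integralS (fun x => gx (x - s) * psi x).
Proof.
move=> dF cf cg cgx gF gxf ppsi dpsi cpsi'.
pose psis x := psi (x + s).
have dpsis x : is_derive x 1 psis (derive1 psi (x + s)).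
  rewrite -[X in is_derive _ _ _ X]mulr1; apply: (@is_derive1_comp _ psi (shift s)).
  - by apply: DeriveDef => //; rewrite derive1E.
  - exact: is_derive_shift.
have cpsis : continuous psis by exact: is_derive_continuous dpsis.
have cpsis' : continuous (fun x => derive1 psi (x + s)).
  exact: continuous_translate.
have ppsi' := periodic_derive1 ppsi.
have ccirc : circular psi.
  apply: circular_continuous => // x.
  by apply/differentiable_continuous/derivable1_diffP.
have ccirc' : circular (derive1 psi) by exact: circular_continuous.
have cgs : circular (fun x => g (x - s)) by exact: circular_shift.
have cgxs : circular (fun x => gx (x - s)) by exact: circular_shift.
rewrite -(@integralS_shift _ s); last exact: circularM.
rewrite -[in RHS](@integralS_shift _ s); last exact: circularM.
rewrite /integralS.
under eq_Rintegral do rewrite addrK.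
under [in RHS]eq_Rintegral do rewrite addrK.
have -> : \int[mu]_(x in `[0, 1]) (g x * derive1 psi (x + s)) =
    \int[mu]_(x in `[0, 1]) (F x * derive1 psi (x + s)).
  by apply: eq_Rintegral => x; rewrite inE => /gF ->.
(* Agreement of [g] with [F] at both ends encodes the continuity of [g] across the corner. *)
have F01 : F 0 = F 1.
  have [pg _ _] := cg.
  by rewrite -!gF ?in_itv/= ?lexx ?ler01// -[LHS]pg add0r.
rewrite (@eq_Rintegral_oo (fun x => gx x * psi (x + s)) (fun x => f x * psis x)).
- rewrite (@Rintegration_by_parts _ F psis f (fun x => derive1 psi (x + s)) 0 1).
  + have -> : psis 1 = psis 0 by rewrite /psis addrC ppsi add0r.
    by rewrite F01 subrr sub0r.
  + exact: ltr01.
  + exact: continuous_subspaceT.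
  + exact: is_derive_LRcontinuous dF.
  + by move=> x _; rewrite derive1E derive_val.
  + exact: continuous_subspaceT.
  + exact: is_derive_LRcontinuous dpsis.
  + by move=> x _; rewrite derive1E derive_val.
- apply: circular_integrable; apply: circularM => //.
  exact: circular_shift.
- apply: continuous_integrable => x; exact: cvgM (cf x) (cpsis x).
- by move=> x /gxf ->.
Qed.

End circle_functions.

(** * The Green function *)

Section green_function.
Context {R : realType}.
Set Implicit Arguments.
Unset Strict Implicit.
Notation mu := (@lebesgue_measure R).
Implicit Types (f h : R -> R) (x y s : R).

Definition parabola x : R := 2^-1 * (x - 2^-1) ^+ 2 + 23 / 24.

Lemma is_derive_horner (p : {poly R}) (F f : R -> R) :
  horner p =1 F -> horner p^`() =1 f -> forall x, is_derive x 1 F (f x).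
Proof.
move=> /funext <- /funext <- x; exact: is_derive_poly.
Qed.

Lemma is_derive_parabola x : is_derive x 1 parabola (x - 2^-1).
Proof.
move: x; apply: (@is_derive_horner (2^-1 *: ('X - 2^-1%:P) ^+ 2 + (23 / 24)%:P)).
  by move=> x; rewrite !hornerE /parabola /=; ring.
by move=> x; rewrite !derivCE !hornerE /=; field.
Qed.

Lemma circular_green : circular (@green R).
Proof.
apply: circular_periodize.
  apply: continuous_measurable_fun; exact: is_derive_continuous is_derive_parabola.
exists 2 => x x01; rewrite ler_norml; apply/andP; split; nra.
Qed.

Lemma circular_green_x : circular (@green_x R).
Proof.
apply: circular_periodize.
  apply: measurable_fun_ifT => //.
    exact: measurable_fun_eqr.
  exact: measurable_funB.
exists 1 => x x01; case: eqP => _; first by rewrite normr0.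
by rewrite ler_norml; apply/andP; split; lra.
Qed.

Lemma normr_green_le x : `|green x| <= 2.
Proof.
rewrite /green /periodize; have := frac_itv x.
by rewrite ler_norml => z01; apply/andP; split; nra.
Qed.

Lemma normr_green_x_le x : `|green_x x| <= 1.
Proof.
rewrite /green_x /periodize; have := frac_itv x.
case: eqP => [_|_]; first by rewrite normr0.
by rewrite ler_norml => z01; apply/andP; split; lra.
Qed.

Lemma green_itv : {in `[0, 1], @green R =1 parabola}.
Proof.
(* At [x = 1] periodicity gives the value at 0, which matches because the parabola is symmetric
   about 1/2. *)
move=> x; rewrite in_itv/= => /andP[x0]; rewrite le_eqVlt => /predU1P[->|x1].
  have [/(_ 0)] := circular_green; rewrite add0r => -> _ _.
  by rewrite /green periodize_id ?lexx ?ltr01// /parabola; field.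
by rewrite /green periodize_id ?x0.
Qed.

Lemma green_x_itv : {in `]0, 1[, forall x, @green_x R x = x - 2^-1}.
Proof.
move=> x; rewrite in_itv/= => /andP[x0 x1].
by rewrite /green_x periodize_id ?gt_eqF// x1 ltW.
Qed.

(** Away from the corner g = g_x^2 / 2 + 23/24; at the corner both sides vanish by the convention
    g_x(0) = 0. *)
Lemma green_mul_green_x x :
  green x * green_x x = 2^-1 * green_x x ^+ 3 + 23 / 24 * green_x x.
Proof.
rewrite /green /green_x /periodize; case: eqP => _; first by ring.
by field.
Qed.

Lemma integralS_by_parts_green (psi : R -> R) s :
  periodic psi 1 -> (forall x, derivable psi x 1) -> continuous (derive1 psi) ->
  integralS (fun x => green (x - s) * derive1 psi x) =
  - integralS (fun x => green_x (x - s) * psi x).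
Proof.
apply: (integralS_by_parts s is_derive_parabola _ circular_green circular_green_x
  green_itv green_x_itv).
by apply: (@continuous_translate _ id) => x; exact: cvg_id.
Qed.

Lemma integralS_by_parts_green2 (psi : R -> R) s :
  periodic psi 1 -> (forall x, derivable psi x 1) -> continuous (derive1 psi) ->
  integralS (fun x => green (x - s) ^+ 2 * derive1 psi x) =
  - integralS (fun x => 2 * green (x - s) * green_x (x - s) * psi x).
Proof.
pose p : {poly R} := (2^-1 *: ('X - 2^-1%:P) ^+ 2 + (23 / 24)%:P) ^+ 2.
have dp x : is_derive x 1 (horner p) p^`().[x] by exact: is_derive_poly.
apply: (@integralS_by_parts _ (horner p) (horner p^`()) (fun x => green x ^+ 2) 
  (fun x => 2 * green x * green_x x)) => //.
- exact: continuous_horner.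
- by apply: circularX; exact: circular_green.
- by apply: circularM (circularZ 2 circular_green) circular_green_x.
- by move=> x /green_itv ->; rewrite /p !hornerE /parabola /=; ring.
- move=> x x01; rewrite green_x_itv// green_itv; last exact: subset_itv_oo_cc.
  by rewrite /p !derivCE !hornerE /= /parabola; field.
Qed.

(** On a period the second factor is al z^2 + be with z = y - 1/2, and g_x(x - y) is affine on
    either side of y = x. The constant be drops out because g_x has mean zero. At [x = 0] both sides
    vanish. *)
Lemma convS_green_x (lam gam x : R) :
  convS green_x (fun y => lam * green y + gam * green_x y ^+ 2) x =
  - (lam / 2 + gam) * (green_x x ^+ 3 / 3 - green_x x / 12).
Proof.
have [pgx _ _] := circular_green_x.
wlog x01 : x / 0 <= x < 1.
  move=> /(_ _ (frac_itv x)); rewrite (periodic_int (Num.floor x) x pgx) => <-.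
  by apply: eq_Rintegral => y _; rewrite addrAC (periodic_int _ _ pgx).
have /andP[x0 x1] := x01.
have cconv : circular (fun y => green_x (x - y) * (lam * green y + gam * green_x y ^+ 2)).
  apply: circularM; first exact/circular_reflect/circular_green_x.
  apply: circularD; apply: circularZ; first exact: circular_green.
  exact/circularX/circular_green_x.
rewrite /convS /integralS (@Rintegral_chasles _ _ 0 x 1)//; last exact: ltW.
pose al := lam / 2 + gam; pose be := lam * (23 / 24).
(* [P w] is a primitive of (w - z)(al z^2 + be): g_x(x - y) equals (x - 1) - z for y < x and x - z
   for y > x, whence [w = x - 1] and then [w = x]. *)
pose P (w : R) : {poly R} :=
  (al / 3 * w) *: ('X - 2^-1%:P) ^+ 3 - (al / 4) *: ('X - 2^-1%:P) ^+ 4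
  + (be * w) *: ('X - 2^-1%:P) - (be / 2) *: ('X - 2^-1%:P) ^+ 2.
have dP w y : is_derive y 1 (horner (P w)) (P w)^`().[y] by exact: is_derive_poly.
have cP w : continuous (horner (P w)^`()) by exact: continuous_horner.
rewrite (Rintegral_primitive x0 (dP (x - 1)) (cP (x - 1))).
- rewrite (Rintegral_primitive (ltW x1) (dP x) (cP x)).
  + rewrite !hornerE /= /green_x periodize_id//.
    by case: eqP => [->|_]; rewrite /al /be; field.
  + exact: circular_integrable.
  + move=> y; rewrite in_itv/= => /andP[xy y1].
    have y01 : y \in `]0, 1[ by rewrite in_itv/= y1 (le_lt_trans x0).
    have y01' : y \in `[0, 1] by exact: subset_itv_oo_cc.
  rewrite (green_x_itv y01) (green_itv y01').
    (* Here x - y is negative, so one period is added first. *)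
    rewrite -[green_x (x - y)]pgx green_x_itv; last first.
      by rewrite in_itv/=; apply/andP; split; lra.
    rewrite /P !derivCE !hornerE /= /parabola /al /be; by field.
- exact: circular_integrable.
- move=> y; rewrite in_itv/= => /andP[y0 yx].
  have y01 : y \in `]0, 1[ by rewrite in_itv/= y0 (lt_trans yx).
  have y01' : y \in `[0, 1] by exact: subset_itv_oo_cc.
  rewrite (green_x_itv y01) (green_itv y01').
  rewrite green_x_itv; last by rewrite in_itv/=; apply/andP; split; lra.
  rewrite /P !derivCE !hornerE /= /parabola /al /be; by field.
Qed.

End green_function.

(** * Regularity of the peakon *)

Section peakon_regularity.
Context {R : realType}.
Set Implicit Arguments.
Unset Strict Implicit.
Notation mu := (@lebesgue_measure R).
Implicit Types (f h : R -> R) (a x y s : R).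

(** For negative x, add a period and use the symmetry of the parabola about 1/2. One formula then
    describes both sides of the crest. *)
Lemma green_norm x : `|x| < 1 -> green x = parabola `|x|.
Proof.
have [x0|x0] := leP 0 x.
  by rewrite ger0_norm// => x1; rewrite green_itv// in_itv/= x0 ltW.
rewrite ltr0_norm// => x1; have [/(_ x) <- _ _] := @circular_green R.
rewrite green_itv; first by rewrite /parabola; field.
by rewrite in_itv/=; apply/andP; split; lra.
Qed.

Lemma continuous_green : continuous (@green R).
Proof.
move=> x; have [pg _ _] := @circular_green R.
pose n : R := (Num.floor x)%:~R; have /andP[x0 x1] : 0 <= x - n < 1 := frac_itv x.
have E : \forall y \near x, parabola `|y - n| = green y.
  (* This radius keeps [y - n] strictly between -1 and 1. *)
  exists (1 - (x - n)) => /=; first by rewrite subr_gt0.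
  move=> y /=; rewrite ltr_norml => /andP[? ?].
  rewrite -green_norm; first exact: periodic_int.
  by rewrite ltr_norml; apply/andP; split; lra.
rewrite /continuous_at -(nbhs_singleton E).
apply: cvg_trans; first by apply: near_eq_cvg E.
apply: (@continuous_comp _ _ _ (fun y => `|y - n|) parabola).
  by apply: cvg_norm; apply: cvgB; [exact: cvg_id|exact: cvg_cst].
exact: is_derive_continuous is_derive_parabola _.
Qed.

Lemma periodic_peakon a : periodic (peakon a) 1.
Proof. exact: periodize_periodic. Qed.

Lemma continuous_peakon a : continuous (peakon a).
Proof.
by move=> x; apply: cvgM; [exact: cvg_cst|exact: continuous_green].
Qed.

Lemma has_peak_peakon a : a != 0 -> has_peak (peakon a) 0.
Proof.
move=> a0; exists (a / 2); first by rewrite mulf_neq0// invr_neq0// pnatr_eq0.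
(* The difference quotients at the crest are exactly a (y/2 + 1/2) on the left and a (y/2 - 1/2) on
   the right. *)
have affine (e : R) : a * (y / 2 + e) @[y --> (0 : R)] --> a * e.
  have := @continuous_horner R (a *: (2^-1 *: 'X + e%:P)) 0.
  have -> : horner (a *: (2^-1 *: 'X + e%:P)) = (fun y => a * (y / 2 + e)).
    by apply/funext => y; rewrite !hornerE /= [y / 2]mulrC.
  by rewrite /continuous_at mul0r add0r.
have g0 : green 0 = parabola 0 :> R by rewrite green_norm normr0.
split.
- apply: cvg_trans (cvg_at_left_filter (affine 2^-1)).
  apply: near_eq_cvg; near=> y.
  have y0 : y < 0 by near: y; exact: nbhs_left_lt.
  have y1 : -1 < y by near: y; exact: (nbhs_left_gt (ltrN10 R)).
  rewrite add0r !peakon_green g0 green_norm ltr0_norm//; last lra.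
  by rewrite /parabola; field; rewrite lt_eqF.
- rewrite -[- (a / 2)]mulrN; apply: cvg_trans (cvg_at_right_filter (affine (- 2^-1))).
  apply: near_eq_cvg; near=> y.
  have y0 : 0 < y by near: y; exact: nbhs_right_gt.
  have y1 : y < 1 by near: y; exact: nbhs_right_lt.
  rewrite add0r !peakon_green g0 green_norm gtr0_norm//.
  by rewrite /parabola; field; rewrite gt_eqF.
Unshelve. all: by end_near. Qed.

(** The circle has total length 1, so a sup bound also bounds the L^3 norm. *)
Lemma W13_norm_le f h (M N : R) : measurable_fun setT f -> measurable_fun setT h ->
  (forall x, `|f x| <= M) -> (forall x, `|h x| <= N) ->
  (W13_norm f h <= ((M ^+ 3 + N ^+ 3)%:E `^ 3^-1))%E.
Proof.
move=> mf mh fM hN.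
have bound (k : R -> R) (K : R) : measurable_fun setT k -> (forall x, `|k x| <= K) ->
    (\int[mu]_(x in `[0%R, 1%R]) (`|k x| ^+ 3)%:E <= (K ^+ 3)%:E)%E.
  move=> mk kK.
  have -> : (K ^+ 3)%:E = (\int[mu]_(x in `[0%R, 1%R]) (K ^+ 3)%:E)%E.
    rewrite integral_cst//= lebesgue_measure_itv/= lte_fin ltr01.
    by rewrite -EFinB subr0 mule1.
  apply: ge0_le_integral => //=.
  - apply/measurable_EFinP/measurable_funX/measurableT_comp => //.
    exact: measurable_funTS.
  - by move=> x _; rewrite lee_fin lerXn2r// nnegrE// (le_trans _ (kK x)).
have int_ge0 (k : R -> R) : (0 <= \int[mu]_(x in `[0%R, 1%R]) (`|k x| ^+ 3)%:E)%E.
  by apply: integral_ge0 => x _; rewrite lee_fin.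
have le3 : (\int[mu]_(x in `[0%R, 1%R]) (`|f x| ^+ 3)%:E +
    \int[mu]_(x in `[0%R, 1%R]) (`|h x| ^+ 3)%:E <= (M ^+ 3 + N ^+ 3)%:E)%E.
  by rewrite EFinD; apply: leeD; exact: bound.
have ge0 := adde_ge0 (int_ge0 f) (int_ge0 h).
apply: gt0_ler_poweR => //; rewrite in_itv/= leey andbT//.
exact: le_trans le3.
Qed.

Lemma circular_peakon a : circular (peakon a).
Proof. apply: circularZ; exact: circular_green. Qed.

Lemma circular_peakon_x a : circular (fun x => a * green_x x).
Proof. apply: circularZ; exact: circular_green_x. Qed.

(** The bound is independent of [s], hence uniform in time for the travelling wave. *)
Lemma W13_norm_peakon a s :
  (W13_norm (fun x => peakon a (x - s))%R (fun x => a * green_x (x - s))%R <=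
   (((2 * `|a|) ^+ 3 + `|a| ^+ 3) `^ 3^-1)%:E)%E.
Proof.
rewrite -poweR_EFin; apply: W13_norm_le.
- by have [] := circular_shift (- s) (circular_peakon a).
- by have [] := circular_shift (- s) (circular_peakon_x a).
- by move=> x; rewrite peakon_green normrM mulrC ler_wpM2r// normr_green_le.
- by move=> x; rewrite normrM ler_piMr// normr_green_x_le.
Qed.

Lemma in_W13_peakon a s :
  in_W13 (fun x => peakon a (x - s)) (fun x => a * green_x (x - s)).
Proof.
have [pp mp _] := circular_shift (- s) (circular_peakon a).
have [px mx _] := circular_shift (- s) (circular_peakon_x a).
split => //; last exact: le_lt_trans (W13_norm_peakon a s) (ltry _).
move=> psi [ppsi dpsi].
(* Smoothness is used at orders 0 and 1: the second derivative exists, so the first one is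
   continuous. *)
have dpsi0 : forall x, derivable psi x 1 := dpsi 0.
have cpsi' : continuous (derive1 psi).
  by move=> x; apply/differentiable_continuous/derivable1_diffP/(dpsi 1).
have cpsi : circular psi.
  apply: circular_continuous => // x.
  by apply/differentiable_continuous/derivable1_diffP.
have cpsi'' := circular_continuous (periodic_derive1 ppsi) cpsi'.
rewrite /integralS; under eq_Rintegral do rewrite peakon_green -mulrA.
under [in RHS]eq_Rintegral do rewrite -mulrA.
rewrite !RintegralZl//.
- by rewrite -mulrN; congr *%R; exact: integralS_by_parts_green.
- apply: circular_integrable; apply: circularM => //.
  exact/circular_shift/circular_green_x.
- apply: circular_integrable; apply: circularM => //.
  exact/circular_shift/circular_green.
Qed.

Lemma in_Linfty_W13_peakon a (c T : R) :
  in_Linfty_W13 T (fun t x => peakon a (x - c * t)) (fun t x => a * green_x (x - c * t)).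
Proof.
have mshift (D : set (R * R)) : measurable_fun D (fun p => p.2 - c * p.1).
  apply: measurable_funB; first exact: measurable_funTS.
  by apply: measurable_funM => //; exact: measurable_funTS.
have [_ mp _] := circular_peakon a.
have [_ mx _] := circular_peakon_x a.
split.
- exact: (measurableT_comp mp).
- exact: (measurableT_comp mx).
- by apply/aeW => t _; exact: in_W13_peakon.
- exists (((2 * `|a|) ^+ 3 + `|a| ^+ 3) `^ 3^-1).
  by apply/aeW => t _; exact: W13_norm_peakon.
Qed.

End peakon_regularity.

(** * Derivatives along a moving frame *)

Section transport.
Context {R : realType}.
Set Implicit Arguments.
Unset Strict Implicit.
Notation mu := (@lebesgue_measure R).
Implicit Types (f h g : R -> R) (w phi : R -> R -> R) (c t x y s T : R).

Definition jointly_continuous w := continuous (fun p : R * R => w p.1 p.2).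

Lemma continuous_along w (p q : R -> R) :
  jointly_continuous w -> continuous p -> continuous q ->
  continuous (fun t => w (p t) (q t)).
Proof.
by move=> cw cp cq t; exact: (cvg_comp2 (cp t) (cq t) (cw (p t, q t))).
Qed.

Lemma continuous_affine (x c : R) : continuous (fun t => x + c * t).
Proof.
move=> t; apply: cvgD; first exact: cvg_cst.
by apply: cvgM; [exact: cvg_cst|exact: cvg_id].
Qed.

Lemma continuous_slice w t : jointly_continuous w -> continuous (w t).
Proof.
move=> cw; apply: continuous_along => //; first exact: cst_continuous.
by move=> x; exact: cvg_id.
Qed.

Lemma circular_slice w t : jointly_continuous w -> (forall t, periodic (w t) 1) ->
  circular (w t).
Proof. by move=> cw pw; apply: circular_continuous => //; exact: continuous_slice. Qed.

(** Periodicity reduces the strip to a compact rectangle. *)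
Lemma bounded_strip w (A B : R) : jointly_continuous w ->
  (forall t, periodic (w t) 1) ->
  exists M, forall t x, t \in `[A, B] -> `|w t x| <= M.
Proof.
move=> cw pw.
have : compact ((fun p : R * R => w p.1 p.2) @` (`[A, B] `*` `[0, 1])).
  apply: continuous_compact; first exact: continuous_subspaceT.
  by apply: compact_setX; exact: segment_compact.
move=> /compact_bounded[M [_ Mw]]; exists (M + 1) => t x tAB.
rewrite -(periodic_int (Num.floor x) x (pw t)).
apply: (Mw (M + 1)); first by rewrite ltrDl.
exists (t, x - (Num.floor x)%:~R) => //=; split => //=.
by rewrite in_itv/=; have /andP[-> /ltW ->] := frac_itv x.
Qed.

(** The mean value theorem for increments of either sign; [e] is the displacement of the
    intermediate point, which tends to 0 with [d]. *)
Lemma mean_value_increment f x (d : R) : (forall y, derivable f y 1) ->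
  exists2 e, `|e| <= `|d| & f (x + d) - f x = d * derive1 f (x + e).
Proof.
move=> df.
have isd y : is_derive y 1 f (derive1 f y) by apply: DeriveDef => //; rewrite derive1E.
have cf : continuous f := is_derive_continuous isd.
have [d0|d0] := leP 0 d.
  have [||z] := @MVT_segment _ f (derive1 f) x (x + d) => //; first by rewrite lerDl.
    exact: continuous_subspaceT.
  rewrite in_itv/= => /andP[xz zd] ->; exists (z - x).
    by rewrite !ger0_norm// ?subr_ge0// lerBlDl.
  by rewrite addrC addKr [RHS]mulrC [x + _]addrC subrK.
have [||z] := @MVT_segment _ f (derive1 f) (x + d) x => //; first by rewrite gerDl ltW.
  exact: continuous_subspaceT.
rewrite in_itv/= => /andP[dz zx] E; exists (z - x).
  by rewrite (ltr0_norm d0) ler0_norm ?subr_le0//; lra.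
rewrite [x + (_ - _)]addrC subrK -opprB E; by ring.
Qed.

Definition C1 phi := [/\ jointly_continuous phi,
  jointly_continuous (deriv_t phi), jointly_continuous (deriv_x phi),
  (forall t x, derivable (fun s => phi s x) t 1) &
  (forall t x, derivable (phi t) x 1)].

(** The increment splits into a space increment at time [t + r], handled by the mean value theorem
    and joint continuity of the space derivative, and a time increment at the fixed point [y]. *)
Lemma is_derive_along phi x c t : C1 phi ->
  is_derive t 1 (fun s => phi s (x + c * s))
    (deriv_t phi t (x + c * t) + c * deriv_x phi t (x + c * t)).
Proof.
move=> [cphi cphit cphix dphit dphix].
pose y := x + c * t.
(* Choice turns the intermediate displacements into a function of [r], so that a limit can be
   taken. *)
have /choice[e eh] : forall r : R, exists d : R, `|d| <= `|c * r| /\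
    phi (t + r) (y + c * r) - phi (t + r) y = c * r * deriv_x phi (t + r) (y + d).
  move=> r; have [d d1 d2] := @mean_value_increment (phi (t + r)) y (c * r) (dphix _).
  by exists d.
have e0 : e r @[r --> (0 : R)] --> (0 : R).
  apply: norm_cvg0.
  have ce : `|c * r| @[r --> (0 : R)] --> (0 : R).
    have : `|c * r| @[r --> (0 : R)] --> `|c * 0|.
      by apply: cvg_norm; apply: cvgM; [exact: cvg_cst|exact: cvg_id].
    by rewrite mulr0 normr0.
  apply: squeeze_cvgr (cvg_cst 0) ce.
  by apply: nearW => r; rewrite normr_ge0 (eh r).1.
have lim_x : deriv_x phi (t + r) (y + e r) @[r --> (0 : R)^'] --> deriv_x phi t y.
  apply: cvg_within_filter.
  have ct : t + r @[r --> (0 : R)] --> t.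
    by rewrite -[in X in _ --> X](addr0 t); apply: cvgD; [exact: cvg_cst|exact: cvg_id].
  have cy : y + e r @[r --> (0 : R)] --> y.
    by rewrite -[in X in _ --> X](addr0 y); apply: cvgD; [exact: cvg_cst|exact: e0].
  exact: (cvg_comp2 ct cy (cphix (t, y))).
have lim_t : r^-1 * (phi (t + r) y - phi t y) @[r --> (0 : R)^'] --> deriv_t phi t y.
  have : derivable (fun s => phi s y) t 1 := dphit t y.
  rewrite /derivable /deriv_t derive1E /derive.
  under eq_fun do rewrite /= [_%:A]mulr1 [_ + t]addrC.
  by move/cvg_ex => [l ll]; rewrite (cvg_lim _ ll).
have key : r^-1 *: ((fun s => phi s (x + c * s)) (r *: 1 + t) - phi t y)
    @[r --> (0 : R)^'] --> deriv_t phi t y + c * deriv_x phi t y.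
  have lim_tx : r^-1 * (phi (t + r) y - phi t y) + c * deriv_x phi (t + r) (y + e r)
      @[r --> (0 : R)^'] --> deriv_t phi t y + c * deriv_x phi t y.
    by apply: cvgD; [exact: lim_t|apply: cvgM; [exact: cvg_cst|exact: lim_x]].
  apply: cvg_trans lim_tx; apply: near_eq_cvg; near=> r.
  have r0 : r != 0 by near: r; exact: nbhs_dnbhs_neq.
  have -> : x + c * (r *: 1 + t) = y + c * r.
    by rewrite /y [r *: 1]mulr1; ring.
  rewrite [r *: 1]mulr1 [r + t]addrC.
  (* Insert the intermediate value at time [t + r] and place [y]. *)
  rewrite -[X in _ = r^-1 *: (X - _)](subrK (phi (t + r) y)) (eh r).2.
  by rewrite /=/GRing.scale/=; field.
apply: DeriveDef; first by apply/cvg_ex; exists (deriv_t phi t y + c * deriv_x phi t y).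
exact: cvg_lim key.
Unshelve. all: by end_near. Qed.

End transport.

(** * Integrating the transport derivative over time and the circle *)

Section transport_identity.
Context {R : realType}.
Set Implicit Arguments.
Unset Strict Implicit.
Notation mu := (@lebesgue_measure R).
Implicit Types (f h g : R -> R) (w phi u ux : R -> R -> R) (c t x y s T : R).

Lemma periodic_deriv_t phi : (forall t, periodic (phi t) 1) ->
  forall t, periodic (deriv_t phi t) 1.
Proof.
by move=> pphi t x; rewrite /deriv_t; under eq_fun do rewrite pphi.
Qed.

Lemma periodic_deriv_x phi : (forall t, periodic (phi t) 1) ->
  forall t, periodic (deriv_x phi t) 1.
Proof. by move=> pphi t; exact: periodic_derive1. Qed.

Lemma Rintegral_transport g phi c T : circular g -> C1 phi ->
  (forall t, periodic (phi t) 1) -> 0 < T ->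
  \int[mu]_(t in `[0, T[)
    integralS (fun x => g (x - c * t) * (deriv_t phi t x + c * deriv_x phi t x)) =
  integralS (fun x => g (x - c * T) * phi T x) - integralS (fun x => g x * phi 0 x).
Proof.
move=> cg C1phi pphi T0; have [cphi cphit cphix dphit dphix] := C1phi.
have [_ _ [N gN]] := cg.
pose D t x := deriv_t phi t x + c * deriv_x phi t x.
have cD : jointly_continuous D.
  move=> p; apply: cvgD; first exact: cphit.
  by apply: cvgM; [exact: cvg_cst|exact: cphix].
have pD t : periodic (D t) 1.
  by move=> x; rewrite /D periodic_deriv_t// periodic_deriv_x.
have along w s : circular (w s) ->
    integralS (fun x => g (x - c * s) * w s x) =
    integralS (fun x => g x * w s (x + c * s)).
  move=> cw; rewrite -(@integralS_shift _ _ (c * s)).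
    by apply: eq_Rintegral => x _; rewrite addrK.
  by apply: circularM => //; exact: circular_shift.
have -> : \int[mu]_(t in `[0, T[)
    integralS (fun x => g (x - c * t) * (deriv_t phi t x + c * deriv_x phi t x)) =
    \int[mu]_(t in `[0, T[) integralS (fun x => g x * D t (x + c * t)).
  by apply: eq_Rintegral => t _; apply: (along D); exact: circular_slice.
have c0 : integralS (fun x => g x * phi 0 x) =
    integralS (fun x => g x * phi 0 (x + c * 0)).
  by apply: eq_Rintegral => x _; rewrite mulr0 addr0.
rewrite c0 along; last exact: circular_slice.
pose F t x := g x * phi t (x + c * t).
pose dF t x := g x * D t (x + c * t).
have int_along w t : jointly_continuous w -> (forall t, periodic (w t) 1) ->
    mu.-integrable `[0, 1] (EFin \o (fun x => g x * w t (x + c * t))).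
  move=> cw pw; apply: circular_integrable; apply: circularM => //.
  exact/circular_shift/circular_slice.
have derF t x : is_derive t 1 (F ^~ x) (dF t x).
  exact: (is_deriveZ (g x) (is_derive_along x c t C1phi)).
have dFE t x : partial1of2 F t x = dF t x by rewrite partial1of2E derive_val.
(* The margin of 1 places [[0, T]] inside an open interval, so two-sided derivatives are available
   at both end times. *)
have [M DM] := bounded_strip (-1) (T + 1) cD pD.
have dF_le t x : `]-1, T + 1[%classic t -> `|dF t x| <= `|N * M|.
  move=> tI; rewrite normrM (le_trans _ (ler_norm _))// ler_pM//.
  by apply: DM; exact: subset_itv_oo_cc.
have int_cst : mu.-integrable `[0, 1] (EFin \o (fun=> `|N * M|)).
  exact: circular_integrable (circular_cst _).
pose J t := \int[mu]_(x in `[0, 1]) F t x.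
pose dJ t := \int[mu]_(x in `[0, 1]) dF t x.
have m01 : measurable (`[0, 1] : set (measurableTypeR R)) by exact: measurable_itv.
have int_F s : `]-1, T + 1[%classic s -> mu.-integrable `[0, 1] (EFin \o F s).
  by move=> _; exact: int_along.
have derF1 s x : `]-1, T + 1[%classic s -> `[0, 1]%classic x -> derivable (F ^~ x) s 1.
  by move=> _ _; exact: (@ex_derive _ _ _ _ _ _ _ (derF s x)).
have dF_le1 s x : `]-1, T + 1[%classic s -> `[0, 1]%classic x ->
    `|partial1of2 F s x| <= `|N * M|.
  by move=> sI _; rewrite dFE; exact: dF_le.
have NM0 (x : measurableTypeR R) : 0 <= `|N * M| by exact: normr_ge0.
have JdJ t : `]-1, T + 1[%classic t -> derivable J t 1 /\ derive1 J t = dJ t.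
  move=> tI; split.
    exact: (derivable_under_integral m01 tI int_F derF1 NM0 int_cst dF_le1).
  transitivity (\int[mu]_(x in `[0, 1]) (partial1of2 F) t x).
    exact: (differentiation_under_integral m01 tI int_F derF1 NM0 int_cst dF_le1).
  by apply: eq_Rintegral => x _; rewrite dFE.
have int_dF s : `]-1, T + 1[%classic s -> mu.-integrable `[0, 1] (EFin \o dF s).
  by move=> _; exact: int_along.
have cD_along x : continuous (fun t => D t (x + c * t)).
  have cid : continuous (@id R) by move=> s; exact: cvg_id.
  by move=> t; have := @continuous_along _ D id _ cD cid (@continuous_affine _ x c) t.
have ctF : {ae mu, forall x, `[0, 1]%classic x ->
    {in (`]-1, T + 1[%classic : set R), continuous (dF ^~ x)}}.
  apply: aeW => x _ t _; apply: cvgM; first exact: cvg_cst.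
  exact: (cD_along x t).
have dF_le2 s : `]-1, T + 1[%classic s ->
    {ae mu, forall x, `[0, 1]%classic x -> `|dF s x| <= `|N * M|}.
  by move=> sI; apply: aeW => x _; exact: dF_le.
(* The fundamental theorem needs a continuous derivative [dJ]; the same constant dominates. *)
have cdJ := continuity_under_integral m01 int_dF ctF int_cst dF_le2.
have sub : `[0, T] `<=` `]-1, T + 1[%classic.
  by apply: subset_itvSoo; rewrite bnd_simp ?ltrN10 ?ltrDl.
have cdJ0T : {within `[0, T], continuous dJ}.
  apply: continuous_in_subspaceT => s /set_mem sT.
  by apply: cdJ; apply/mem_set/sub.
have int_dJ : mu.-integrable `[0, T] (EFin \o dJ).
  by apply: continuous_compact_integrable => //; exact: segment_compact.
rewrite Rintegral_itv_bndo_bndc; last first.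
  by apply: integrableS int_dJ => //; apply: subset_itvl; rewrite bnd_simp.
have cJ t : `[0, T]%classic t -> {for t, continuous J}.
  move=> /sub/JdJ[dJt _].
  exact/differentiable_continuous/derivable1_diffP.
rewrite /Rintegral (@continuous_FTC2 _ dJ J)//.
- split.
  + by move=> t tT; apply: (JdJ t _).1; apply: sub; exact: subset_itv_oo_cc.
  + by apply/cvg_at_right_filter/cJ; rewrite /= in_itv/= lexx ltW.
  + by apply/cvg_at_left_filter/cJ; rewrite /= in_itv/= lexx ltW.
- by move=> t tT; apply: (JdJ t _).2; apply: sub; exact: subset_itv_oo_cc.
Qed.

End transport_identity.

(** * The weak form *)

Section weak_form.
Context {R : realType}.
Set Implicit Arguments.
Unset Strict Implicit.
Notation mu := (@lebesgue_measure R).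
Implicit Types (f h g : R -> R) (w phi u ux : R -> R -> R) (c t x y s T : R).

Lemma test_function_C1 T phi : test_function T phi -> C1 phi.
Proof.
move=> [/(_ 1) [cphi [dphit dphix [cphit _] [cphix _]]] _ _].
exact: And5 cphi cphit cphix dphit dphix.
Qed.

Lemma integralSD f h : circular f -> circular h ->
  integralS (fun x => f x + h x) = integralS f + integralS h.
Proof. by move=> cf ch; rewrite /integralS RintegralD//; exact: circular_integrable. Qed.

Lemma integralSZ (k : R) f : circular f ->
  integralS (fun x => k * f x) = k * integralS f.
Proof. by move=> cf; rewrite /integralS RintegralZl//; exact: circular_integrable. Qed.

Lemma convS_shift f h s x : circular f -> circular h ->
  convS f (fun y => h (y - s)) x = convS f h (x - s).
Proof.
move=> cf ch; rewrite /convS -(@integralS_shift _ _ s); last first.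
  by apply: circularM; [exact: circular_reflect|exact: circular_shift].
by apply: eq_Rintegral => y _; rewrite addrK opprD addrA addrAC.
Qed.

(** The squared term contributes 1/24, and 23/24 completes it to 1; hence the mean of the peakon is
    [a]. *)
Lemma integralS_green : integralS (@green R) = 1.
Proof.
pose p : {poly R} := (1 / 6) *: ('X - 2^-1%:P) ^+ 3 + (23 / 24) *: 'X.
have dp y : is_derive y 1 (horner p) p^`().[y] by exact: is_derive_poly.
have cp : continuous (horner p^`()) by exact: continuous_horner.
rewrite /integralS (Rintegral_primitive ler01 dp cp).
- by rewrite /p !hornerE /=; field.
- exact/circular_integrable/circular_green.
- move=> x x01; rewrite green_itv; last exact: subset_itv_oo_cc.
  by rewrite /p !derivCE !hornerE /= /parabola; field.
Qed.

(** The integrand is odd about 1/2; this removes the term in the mean of u_x^3. *)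
Lemma integralS_green_x3 : integralS (fun x => @green_x R x ^+ 3) = 0.
Proof.
pose p : {poly R} := 4^-1 *: ('X - 2^-1%:P) ^+ 4.
have dp y : is_derive y 1 (horner p) p^`().[y] by exact: is_derive_poly.
have cp : continuous (horner p^`()) by exact: continuous_horner.
rewrite /integralS (Rintegral_primitive ler01 dp cp).
- by rewrite /p !hornerE /=; field.
- exact/circular_integrable/circularX/circular_green_x.
- move=> x x01; rewrite green_x_itv//.
  by rewrite /p !derivCE !hornerE /=; field.
Qed.

(** After the convolutions, the coefficient of phi is k1 a^3 (G_x^3 - G_x/6) + k2 a^2 (G_x^3/2 -
    G_x/8). Trading cubes for G G_x turns the brackets into 2 G G_x - 25 G_x/12 and G G_x - 13
    G_x/12, which is where 25 and 13 come from. *)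
Lemma weak_integrand_peakon (k1 k2 c a : R) phi t x :
  25 * k1 * a ^+ 2 + 13 * k2 * a = 12 * c ->
  weak_integrand k1 k2 (fun t x => peakon a (x - c * t))
    (fun t x => a * green_x (x - c * t)) phi t x =
  a * (green (x - c * t) * deriv_t phi t x)
  + (k1 * a ^+ 3 + k2 * a ^+ 2 / 2) *
    (green (x - c * t) ^+ 2 * deriv_x phi t x +
     2 * green (x - c * t) * green_x (x - c * t) * phi t x)
  + - (a * c) * (green_x (x - c * t) * phi t x).
Proof.
move=> kac; pose s := c * t.
have mean : integralS (fun x => peakon a (x - s)) = a.
  rewrite (@integralS_shift _ (peakon a)); last exact: circular_peakon.
  by rewrite integralSZ ?integralS_green ?mulr1//; exact: circular_green.
have cube : integralS (fun y => (a * green_x (y - s)) ^+ 3) = 0.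
  rewrite (@integralS_shift _ (fun y => (a * green_x y) ^+ 3)); last first.
    exact/circularX/circular_peakon_x.
  under [integralS _]eq_Rintegral do rewrite exprMn.
  rewrite [LHS]integralSZ ?integralS_green_x3 ?mulr0//.
  exact/circularX/circular_green_x.
have conv (lam gam : R) :
    convS green_x (fun y => lam * peakon a (y - s) + gam * (a * green_x (y - s)) ^+ 2) x =
    - (lam * a / 2 + gam * a ^+ 2) *
      (green_x (x - s) ^+ 3 / 3 - green_x (x - s) / 12).
  rewrite -convS_green_x -convS_shift; last 2 first.
  - exact: circular_green_x.
  - apply: circularD; apply: circularZ; first exact: circular_green.
    exact/circularX/circular_green_x.
  by apply: eq_Rintegral => y _; rewrite peakon_green; congr (_ * _); ring.
rewrite /weak_integrand mean cube conv.
(* The k2 convolution, reordered to fit [conv] with [lam = 2 * a] and [gam = 2^-1]. *)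
have -> : convS green_x (fun y => 2 * peakon a (y - c * t) * a +
    2^-1 * (a * green_x (y - c * t)) ^+ 2) x =
    - ((2 * a) * a / 2 + 2^-1 * a ^+ 2) *
      (green_x (x - s) ^+ 3 / 3 - green_x (x - s) / 12).
  rewrite -conv; apply: eq_Rintegral => y _; congr (_ * _).
  by rewrite -/s; ring.
rewrite peakon_green -/s -[2 * green _ * _]mulrA green_mul_green_x.
have -> : c = (25 * k1 * a ^+ 2 + 13 * k2 * a) / 12 by rewrite kac; field.
by field.
Qed.

(** The G^2 bracket integrates to zero as a total derivative, and the G_x term becomes a c times the
    integral of G phi_x. *)
Lemma integralS_weak_integrand_peakon (k1 k2 c a : R) phi t :
  25 * k1 * a ^+ 2 + 13 * k2 * a = 12 * c ->
  C1 phi -> (forall t, periodic (phi t) 1) ->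
  integralS (weak_integrand k1 k2 (fun t x => peakon a (x - c * t))
    (fun t x => a * green_x (x - c * t)) phi t) =
  integralS (fun x =>
    peakon a (x - c * t) * (deriv_t phi t x + c * deriv_x phi t x)).
Proof.
move=> kac [cphi cphit cphix dphit dphix] pphi; pose s := c * t.
have c0 := circular_slice t cphi pphi.
have ct := circular_slice t cphit (periodic_deriv_t pphi).
have cx := circular_slice t cphix (periodic_deriv_x pphi).
have cdx : continuous (derive1 (phi t)) := continuous_slice cphix.
have cg := circular_shift (- s) (@circular_green R).
have cgx := circular_shift (- s) (@circular_green_x R).
have ctx1 := circularM cg ct; have ctx2 := circularM cg cx.
have c2x := circularM (circularX 2 cg) cx.
have c2 := circularM (circularM (circularZ 2 cg) cgx) c0.
have c3 := circularM cgx c0.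
transitivity (a * integralS (fun x => green (x - s) * deriv_t phi t x) +
    a * c * integralS (fun x => green (x - s) * deriv_x phi t x)).
- have ibp := integralS_by_parts_green s (pphi t) (dphix t) cdx.
  have ibp2 := integralS_by_parts_green2 s (pphi t) (dphix t) cdx.
  transitivity (integralS (fun x => a * (green (x - s) * deriv_t phi t x)
    + (k1 * a ^+ 3 + k2 * a ^+ 2 / 2) * (green (x - s) ^+ 2 * deriv_x phi t x +
      2 * green (x - s) * green_x (x - s) * phi t x)
    + - (a * c) * (green_x (x - s) * phi t x))).
    by apply: eq_Rintegral => x _; exact: weak_integrand_peakon.
  rewrite integralSD; last 2 first.
  - by apply: circularD; apply: circularZ => //; exact: circularD.
  - exact: circularZ.
  rewrite integralSD; last 2 first.
  - exact: circularZ.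
  - by apply: circularZ; exact: circularD.
  rewrite !integralSZ//; last exact: circularD.
  rewrite (integralSD c2x c2) ibp2 ibp; ring.
- rewrite -!integralSZ// -integralSD; last 2 first.
  - exact: circularZ.
  - exact: circularZ.
  by apply: eq_Rintegral => x _; rewrite peakon_green -/s; ring.
Qed.

Lemma weak_solution_peakon (k1 k2 c a T : R) :
  25 * k1 * a ^+ 2 + 13 * k2 * a = 12 * c -> 0 < T ->
  weak_solution k1 k2 T (peakon a) (fun t x => peakon a (x - c * t)).
Proof.
move=> kac T0; split.
  (* The initial datum is the wave with shift 0. *)
  exists (fun x => a * green_x x); have := in_W13_peakon a 0.
  by under eq_fun do rewrite subr0; under [X in in_W13 _ X]eq_fun do rewrite subr0.
exists (fun t x => a * green_x (x - c * t)); first exact: in_Linfty_W13_peakon.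
move=> phi tphi; have C1phi := test_function_C1 tphi.
have [_ pphi [T' T'T phi0]] := tphi.
under eq_Rintegral do rewrite integralS_weak_integrand_peakon//.
rewrite Rintegral_transport//; last exact: circular_peakon.
(* The initial terms cancel; what remains is at time [T], where [phi] vanishes because [T' < T]. *)
rewrite subrK /integralS; under eq_Rintegral do rewrite phi0 ?ltW// mulr0.
by rewrite Rintegral_cst// mul0r.
Qed.

(** The quadratic formula, with both roots treated at once through a square root [r] of the
    radicand. With k1 = 0 the equation is linear. *)
Lemma amplitude_equation (k1 k2 c a : R) :
  (0 < k1 -> - ((169 * k2 ^+ 2) / (1200 * k1)) <= c) ->
  (k1 < 0 -> c <= - ((169 * k2 ^+ 2) / (1200 * k1))) ->
  [\/ k1 != 0 /\
        a = (- 13 * k2 + Num.sqrt (169 * k2 ^+ 2 + 1200 * c * k1)) / (50 * k1),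
      k1 != 0 /\
        a = (- 13 * k2 - Num.sqrt (169 * k2 ^+ 2 + 1200 * c * k1)) / (50 * k1)
    | [/\ k1 = 0, k2 != 0 & a = (12 * c) / (13 * k2)]] ->
  25 * k1 * a ^+ 2 + 13 * k2 * a = 12 * c.
Proof.
move=> c_ge c_le.
have sqr_root (r : R) : k1 != 0 -> r ^+ 2 = 169 * k2 ^+ 2 + 1200 * c * k1 ->
    a = (- 13 * k2 + r) / (50 * k1) -> 25 * k1 * a ^+ 2 + 13 * k2 * a = 12 * c.
  move=> k10 r2 ->.
  have -> : 25 * k1 * ((- 13 * k2 + r) / (50 * k1)) ^+ 2 +
      13 * k2 * ((- 13 * k2 + r) / (50 * k1)) = (r ^+ 2 - 169 * k2 ^+ 2) / (100 * k1).
    by field.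
  by rewrite r2; field.
have disc : k1 != 0 -> 0 <= 169 * k2 ^+ 2 + 1200 * c * k1.
  move=> k10; pose b := - ((169 * k2 ^+ 2) / (1200 * k1)).
  (* Factored this way, the radicand is nonnegative when [c - b] and [k1] have the same sign, which
     the two bounds on [c] ensure. *)
  have -> : 169 * k2 ^+ 2 + 1200 * c * k1 = 1200 * ((c - b) * k1).
    by rewrite /b; field.
  apply: mulr_ge0; first exact: ler0n.
  have [k1n|k1p|k1e] := ltgtP k1 0.
  - by apply: mulr_le0; [rewrite subr_le0; exact: c_le|exact: ltW].
  - by apply: mulr_ge0; [rewrite subr_ge0; exact: c_ge|exact: ltW].
  - by rewrite k1e eqxx in k10.
case=> [[k10 aE]|[k10 aE]|[-> k20 ->]]; last by field.
- exact: (sqr_root _ k10 (sqr_sqrtr (disc k10)) aE).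
- have := sqr_sqrtr (disc k10); rewrite -sqrrN => r2.
  exact: (sqr_root _ k10 r2 aE).
Qed.

End weak_form.

(** Multiplying by a negative k1 reverses the inequality that makes the radicand nonnegative, hence
    a bound on [c] for each sign. For [a = 0] the profile vanishes identically and has no peak,
    hence the condition [a != 0]. *)
Theorem theorem4p1 (R : realType) (k1 k2 c a : R)
  (c_ge : 0 < k1 -> - ((169 * k2 ^+ 2) / (1200 * k1)) <= c)
  (c_le : k1 < 0 -> c <= - ((169 * k2 ^+ 2) / (1200 * k1)))
  (a_def :
    [\/ k1 != 0 /\
          a = (- 13 * k2 + Num.sqrt (169 * k2 ^+ 2 + 1200 * c * k1)) / (50 * k1),
        k1 != 0 /\
          a = (- 13 * k2 - Num.sqrt (169 * k2 ^+ 2 + 1200 * c * k1)) / (50 * k1)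
      | [/\ k1 = 0, k2 != 0 & a = (12 * c) / (13 * k2)]]) :
  [/\ periodic (peakon a) 1,
      continuous (peakon a),
      a != 0 -> has_peak (peakon a) 0 &
      forall T : R, 0 < T ->
        weak_solution k1 k2 T (peakon a) (fun t x => peakon a (x - c * t))].
Proof.
have kac := amplitude_equation c_ge c_le a_def.
split; [exact: periodic_peakon|exact: continuous_peakon|exact: has_peak_peakon|].
by move=> T T0; exact: weak_solution_peakon.
Qed.
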